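(* There is, for each finite type $\sigma$, an $\mathsf{HA}^\omega$-formula $E_\sigma(x)$ (with free variable $x:\sigma$) and an $\mathsf{HA}^\omega$-formula $Q_\sigma(x,y)$ (with free variables $x,y:\sigma$) such that, letting $\varphi^I$ denote the result of replacing in a formula $\varphi$ of the language of $\mathsf{HE}\text{-}\mathsf{HA}^\omega$ every atomic subformula $\mathrm{Ext}_\sigma(t)$ by $E_\sigma(t)$ and every $s=_\sigma t$ by $Q_\sigma(s,t)$ (so that $\varphi^I=\varphi$ for $\mathsf{HA}^\omega$-formulas $\varphi$), we have: $\mathsf{HE}\text{-}\mathsf{HA}^\omega\vdash\varphi$ implies $\mathsf{HA}^\omega\vdash\varphi^I$. Consequently $\mathsf{HE}\text{-}\mathsf{HA}^\omega$ is a conservative extension of $\mathsf{HA}^\omega$.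
   Context: Finite types are generated by: $0$ is a type; if $\sigma,\tau$ are types, so are $\sigma\times\tau$ and $\sigma\to\tau$. $\mathsf{HA}^\omega$ is the many-sorted intuitionistic first-order theory whose sorts are the finite types. Its terms are built from variables and, for all types $\rho,\sigma,\tau$, the constants $\mathsf{k}:\rho\to\sigma\to\rho$, $\mathsf{s}:(\rho\to\sigma\to\tau)\to(\rho\to\sigma)\to(\rho\to\tau)$, $\mathsf{pair}:\sigma\to\tau\to\sigma\times\tau$, $\mathsf{fst}:\sigma\times\tau\to\sigma$, $\mathsf{snd}:\sigma\times\tau\to\tau$, $0:0$, $S:0\to0$, $\mathsf{R}:\sigma\to(0\to\sigma\to\sigma)\to0\to\sigma$, by application (associating to the left). Atomic formulas are $\bot$ and $s\equiv_\sigma t$. Axioms: $\equiv_\sigma$ is an equivalence relation; $x\equiv x'\to y\equiv y'\to xy\equiv x'y'$; $\mathsf{k}xy\equiv x$; $\mathsf{s}xyz\equiv xz(yz)$; $\mathsf{fst}(\mathsf{pair}\,xy)\equiv x$; $\mathsf{snd}(\mathsf{pair}\,xy)\equiv y$; $\mathsf{R}xy0\equiv x$; $\mathsf{R}xy(Sm)\equiv ym(\mathsf{R}xym)$; $Sx\equiv_0Sy\to x\equiv_0y$; $\neg(Sx\equiv_00)$; induction for all formulas. Surjective pairing is not assumed. $\mathsf{H}\text{-}\mathsf{HA}^\omega$ extends the language of $\mathsf{HA}^\omega$ with, for each type $\sigma$, a unary predicate $\mathrm{Ext}_\sigma$ and a binary predicate $=_\sigma$; $\forall^{\mathrm{Ext}}x:\sigma.\psi$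 abbreviates $\forall x:\sigma(\mathrm{Ext}_\sigma(x)\to\psi)$. Its axioms are those of $\mathsf{HA}^\omega$, induction for all formulas of the extended language, and for all $\sigma,\tau$: $x=_0y\leftrightarrow x\equiv_0y$; $\forall x:0\,\mathrm{Ext}_0(x)$; $x=_{\sigma\times\tau}y\leftrightarrow(\mathsf{fst}\,x=_\sigma\mathsf{fst}\,y\wedge\mathsf{snd}\,x=_\tau\mathsf{snd}\,y)$; $\mathrm{Ext}_{\sigma\times\tau}(x)\leftrightarrow(\mathrm{Ext}_\sigma(\mathsf{fst}\,x)\wedge\mathrm{Ext}_\tau(\mathsf{snd}\,x))$; $f=_{\sigma\to\tau}g\leftrightarrow\forall^{\mathrm{Ext}}x:\sigma.fx=_\tau gx$; $\mathrm{Ext}_{\sigma\to\tau}(f)\to\mathrm{Ext}_\sigma(x)\to\mathrm{Ext}_\tau(fx)$; $x\equiv_\sigma y\to\mathrm{Ext}_\sigma(x)\to\mathrm{Ext}_\sigma(y)$; $\mathrm{Ext}(c)$ for each constant $c$. $\mathsf{HE}\text{-}\mathsf{HA}^\omega$ is $\mathsf{H}\text{-}\mathsf{HA}^\omega$ plus, for all $\sigma,\tau$, the axiom $\mathrm{Ext}_{\sigma\to\tau}(f)\to\mathrm{Ext}_\sigma(x)\to\mathrm{Ext}_\sigma(y)\to x=_\sigma y\to fx=_\tau fy$. *)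

(* Defs.v *)
From Stdlib Require Import List.
Import ListNotations.

Set Implicit Arguments.

Inductive ty : Type :=
| Nat : ty
| Prod : ty -> ty -> ty
| Arr : ty -> ty -> ty.

Declare Scope ty_scope.
Delimit Scope ty_scope with ty.
Bind Scope ty_scope with ty.
Notation "s ~> t" := (Arr s t) (at level 55, right associativity) : ty_scope.
Notation "s ** t" := (Prod s t) (at level 50, left associativity) : ty_scope.

(* Variables are typed de Bruijn indices: [term G s] and [form L G] below
    consist of the terms (of type [s]) and formulas whose free variables are
    among those declared in [G], the head of [G] being index 0. *)
Definition ctx : Type := list ty.

Inductive var : ctx -> ty -> Type :=
| vz : forall (G : ctx) (s : ty), var (s :: G) s
| vs : forall (G : ctx) (s r : ty), var G s -> var (r :: G) s.
Arguments vz {G s}.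
Arguments vs {G s r} _.

Inductive const : ty -> Type :=
| cK : forall r s : ty, const (r ~> s ~> r)
| cS : forall r s t : ty, const ((r ~> s ~> t) ~> (r ~> s) ~> (r ~> t))
| cPair : forall s t : ty, const (s ~> t ~> s ** t)
| cFst : forall s t : ty, const (s ** t ~> s)
| cSnd : forall s t : ty, const (s ** t ~> t)
| cZero : const Nat
| cSucc : const (Nat ~> Nat)
| cRec : forall s : ty, const (s ~> (Nat ~> s ~> s) ~> Nat ~> s).

Inductive term (G : ctx) : ty -> Type :=
| Var : forall s : ty, var G s -> term G s
| Const : forall s : ty, const s -> term G s
| App : forall s t : ty, term G (s ~> t) -> term G s -> term G t.
Arguments Var {G s} _.
Arguments Const {G s} _.
Arguments App {G s t} _ _.

Declare Scope tm_scope.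
Delimit Scope tm_scope with tm.
Bind Scope tm_scope with term.
Notation "f @ x" := (App f x) (at level 36, left associativity) : tm_scope.

Definition K {G r s} : term G (r ~> s ~> r) := Const (cK r s).
Definition Sc {G r s t} : term G ((r ~> s ~> t) ~> (r ~> s) ~> (r ~> t)) :=
  Const (cS r s t).
Definition pair_ {G s t} : term G (s ~> t ~> s ** t) := Const (cPair s t).
Definition fst_ {G s t} : term G (s ** t ~> s) := Const (cFst s t).
Definition snd_ {G s t} : term G (s ** t ~> t) := Const (cSnd s t).
Definition zero {G} : term G Nat := Const cZero.
Definition succ {G} : term G (Nat ~> Nat) := Const cSucc.
Definition Rec {G s} : term G (s ~> (Nat ~> s ~> s) ~> Nat ~> s) :=
  Const (cRec s).

(* [Base] is the language of HA^omega; [Extended] adds the predicates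
    Ext and =. *)
Inductive lang : Type := Base | Extended.

Inductive form : lang -> ctx -> Type :=
| Bot : forall L G, form L G
| Equiv : forall L G (s : ty), term G s -> term G s -> form L G
| Ext : forall G (s : ty), term G s -> form Extended G
| Eq : forall G (s : ty), term G s -> term G s -> form Extended G
| And : forall L G, form L G -> form L G -> form L G
| Or : forall L G, form L G -> form L G -> form L G
| Imp : forall L G, form L G -> form L G -> form L G
| All : forall L G (s : ty), form L (s :: G) -> form L G
| Ex : forall L G (s : ty), form L (s :: G) -> form L G.
Arguments Bot {L G}.
Arguments Equiv {L G s} _ _.
Arguments Ext {G s} _.
Arguments Eq {G s} _ _.
Arguments And {L G} _ _.
Arguments Or {L G} _ _.
Arguments Imp {L G} _ _.
Arguments All {L G} s _.
Arguments Ex {L G} s _.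

Definition Not {L G} (A : form L G) : form L G := Imp A Bot.
Definition Iff {L G} (A B : form L G) : form L G := And (Imp A B) (Imp B A).
Definition AllExt {G} (s : ty) (A : form Extended (s :: G)) : form Extended G :=
  All s (Imp (Ext (Var vz)) A).

Declare Scope fm_scope.
Delimit Scope fm_scope with fm.
Bind Scope fm_scope with form.
Notation "x ≡ y" := (Equiv x%tm y%tm) (at level 70, no associativity) : fm_scope.
Notation "x ≐ y" := (Eq x%tm y%tm) (at level 70, no associativity) : fm_scope.
Notation "A ⟶ B" := (Imp A B) (at level 99, right associativity, B at level 200)
  : fm_scope.

Definition ren (D G : ctx) : Type := forall s : ty, var D s -> var G s.
Definition sub (D G : ctx) : Type := forall s : ty, var D s -> term G s.

Definition ren_up {D G : ctx} {s : ty} (f : ren D G) : ren (s :: D) (s :: G) :=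
  fun r v =>
    match v in var D' r'
      return match D' with
             | [] => unit
             | s' :: D'' => ren D'' G -> var (s' :: G) r'
             end
    with
    | vz => fun _ => vz
    | vs w => fun f => vs (f _ w)
    end f.

Fixpoint ren_term {D G : ctx} (f : ren D G) {s : ty} (x : term D s) : term G s :=
  match x with
  | Var v => Var (f _ v)
  | Const c => Const c
  | App y z => App (ren_term f y) (ren_term f z)
  end.

Fixpoint ren_form {L : lang} {D : ctx} (A : form L D) :
    forall G : ctx, ren D G -> form L G :=
  match A with
  | Bot => fun G f => Bot
  | Equiv x y => fun G f => Equiv (ren_term f x) (ren_term f y)
  | Ext x => fun G f => Ext (ren_term f x)
  | Eq x y => fun G f => Eq (ren_term f x) (ren_term f y)
  | And B C => fun G f => And (ren_form B f) (ren_form C f)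
  | Or B C => fun G f => Or (ren_form B f) (ren_form C f)
  | Imp B C => fun G f => Imp (ren_form B f) (ren_form C f)
  | All s B => fun G f => All s (ren_form B (ren_up f))
  | Ex s B => fun G f => Ex s (ren_form B (ren_up f))
  end.

Definition shift {G : ctx} {r : ty} : ren G (r :: G) := fun s v => vs v.
Definition wk_term {G : ctx} {r s : ty} (x : term G s) : term (r :: G) s :=
  ren_term shift x.
Definition wk_form {L : lang} {G : ctx} {r : ty} (A : form L G) : form L (r :: G) :=
  ren_form A shift.

Definition snil {G : ctx} : sub [] G :=
  fun r v =>
    match v in var D' r' return match D' with [] => term G r' | _ => unit end with
    | vz => tt
    | vs _ => tt
    end.

Definition scons {D G : ctx} {s : ty} (x : term G s) (f : sub D G) : sub (s :: D) G :=
  fun r v =>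
    match v in var D' r'
      return match D' with
             | [] => unit
             | s' :: D'' => term G s' -> sub D'' G -> term G r'
             end
    with
    | vz => fun x _ => x
    | vs w => fun _ f => f _ w
    end x f.

Definition sub_up {D G : ctx} {s : ty} (f : sub D G) : sub (s :: D) (s :: G) :=
  scons (Var vz) (fun r v => wk_term (f r v)).

Fixpoint sub_term {D G : ctx} (f : sub D G) {s : ty} (x : term D s) : term G s :=
  match x with
  | Var v => f _ v
  | Const c => Const c
  | App y z => App (sub_term f y) (sub_term f z)
  end.

Fixpoint sub_form {L : lang} {D : ctx} (A : form L D) :
    forall G : ctx, sub D G -> form L G :=
  match A with
  | Bot => fun G f => Bot
  | Equiv x y => fun G f => Equiv (sub_term f x) (sub_term f y)
  | Ext x => fun G f => Ext (sub_term f x)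
  | Eq x y => fun G f => Eq (sub_term f x) (sub_term f y)
  | And B C => fun G f => And (sub_form B f) (sub_form C f)
  | Or B C => fun G f => Or (sub_form B f) (sub_form C f)
  | Imp B C => fun G f => Imp (sub_form B f) (sub_form C f)
  | All s B => fun G f => All s (sub_form B (sub_up f))
  | Ex s B => fun G f => Ex s (sub_form B (sub_up f))
  end.

Definition inst {L : lang} {G : ctx} {s : ty} (A : form L (s :: G)) (x : term G s) :
    form L G :=
  sub_form A (scons x (fun r v => Var v)).

(* The formula A(S n) in the context of A(n). *)
Definition inst_succ {L : lang} {G : ctx} (A : form L (Nat :: G)) : form L (Nat :: G) :=
  sub_form A (scons (App succ (Var vz)) (fun r v => Var (vs v))).

(* A theory is given by its axioms, which may contain free variables.
    Since every type is inhabited by a closed term, provability of a formula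
    does not depend on the context in which it is considered. *)
Definition theory (L : lang) : Type := forall G : ctx, form L G -> Prop.

Inductive prf (L : lang) (T : theory L) : forall G : ctx, list (form L G) -> form L G -> Prop :=
| p_ax : forall G H (A : form L G), T G A -> prf T H A
| p_hyp : forall G H (A : form L G), In A H -> prf T H A
| p_botE : forall G H (A : form L G), prf T H Bot -> prf T H A
| p_andI : forall G H (A B : form L G), prf T H A -> prf T H B -> prf T H (And A B)
| p_andE1 : forall G H (A B : form L G), prf T H (And A B) -> prf T H A
| p_andE2 : forall G H (A B : form L G), prf T H (And A B) -> prf T H B
| p_orI1 : forall G H (A B : form L G), prf T H A -> prf T H (Or A B)
| p_orI2 : forall G H (A B : form L G), prf T H B -> prf T H (Or A B)
| p_orE : forall G H (A B C : form L G),
    prf T H (Or A B) -> prf T (A :: H) C -> prf T (B :: H) C -> prf T H C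
| p_impI : forall G H (A B : form L G), prf T (A :: H) B -> prf T H (Imp A B)
| p_impE : forall G H (A B : form L G), prf T H (Imp A B) -> prf T H A -> prf T H B
| p_allI : forall G H s (A : form L (s :: G)),
    prf T (map wk_form H) A -> prf T H (All s A)
| p_allE : forall G H s (A : form L (s :: G)) (x : term G s),
    prf T H (All s A) -> prf T H (inst A x)
| p_exI : forall G H s (A : form L (s :: G)) (x : term G s),
    prf T H (inst A x) -> prf T H (Ex s A)
| p_exE : forall G H s (A : form L (s :: G)) (C : form L G),
    prf T H (Ex s A) -> prf T (A :: map wk_form H) (wk_form C) -> prf T H C.

Definition provable {L : lang} (T : theory L) {G : ctx} (A : form L G) : Prop :=
  prf T [] A.

Local Open Scope fm_scope.

(* Axioms with free variables are given by all their substitution instances.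
    [HA_axioms L] has induction for all formulas of the language [L]. *)
Inductive HA_axioms (L : lang) : theory L :=
| ax_refl : forall G s (x : term G s), HA_axioms (x ≡ x)
| ax_sym : forall G s (x y : term G s), HA_axioms (x ≡ y ⟶ y ≡ x)
| ax_trans : forall G s (x y z : term G s),
    HA_axioms (x ≡ y ⟶ y ≡ z ⟶ x ≡ z)
| ax_cong : forall G s t (x x' : term G (s ~> t)) (y y' : term G s),
    HA_axioms (x ≡ x' ⟶ y ≡ y' ⟶ x @ y ≡ x' @ y')
| ax_k : forall G r s (x : term G r) (y : term G s),
    HA_axioms (K @ x @ y ≡ x)
| ax_s : forall G r s t
    (x : term G (r ~> s ~> t)) (y : term G (r ~> s)) (z : term G r),
    HA_axioms (Sc @ x @ y @ z ≡ x @ z @ (y @ z))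
| ax_fst : forall G s t (x : term G s) (y : term G t),
    HA_axioms (fst_ @ (pair_ @ x @ y) ≡ x)
| ax_snd : forall G s t (x : term G s) (y : term G t),
    HA_axioms (snd_ @ (pair_ @ x @ y) ≡ y)
| ax_rec0 : forall G s (x : term G s) (y : term G (Nat ~> s ~> s)),
    HA_axioms (Rec @ x @ y @ zero ≡ x)
| ax_recS : forall G s (x : term G s) (y : term G (Nat ~> s ~> s)) (m : term G Nat),
    HA_axioms (Rec @ x @ y @ (succ @ m) ≡ y @ m @ (Rec @ x @ y @ m))
| ax_succ_inj : forall G (x y : term G Nat),
    HA_axioms (succ @ x ≡ succ @ y ⟶ x ≡ y)
| ax_succ_zero : forall G (x : term G Nat), HA_axioms (Not (succ @ x ≡ zero))
| ax_ind : forall G (A : form L (Nat :: G)),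
    HA_axioms (inst A zero ⟶ All Nat (A ⟶ inst_succ A) ⟶ All Nat A).

Inductive H_HA_axioms : theory Extended :=
| ax_HA : forall G (A : form Extended G), HA_axioms A -> H_HA_axioms A
| ax_eq_nat : forall G (x y : term G Nat), H_HA_axioms (Iff (x ≐ y) (x ≡ y))
| ax_ext_nat : forall G, @H_HA_axioms G (All Nat (Ext (Var vz)))
| ax_eq_prod : forall G s t (x y : term G (s ** t)),
    H_HA_axioms (Iff (x ≐ y) (And (fst_ @ x ≐ fst_ @ y) (snd_ @ x ≐ snd_ @ y)))
| ax_ext_prod : forall G s t (x : term G (s ** t)),
    H_HA_axioms (Iff (Ext x) (And (Ext (fst_ @ x)) (Ext (snd_ @ x))))
| ax_eq_arr : forall G s t (f g : term G (s ~> t)),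
    H_HA_axioms
      (Iff (f ≐ g) (AllExt (wk_term f @ Var vz ≐ wk_term g @ Var vz)))
| ax_ext_app : forall G s t (f : term G (s ~> t)) (x : term G s),
    H_HA_axioms (Ext f ⟶ Ext x ⟶ Ext (f @ x))
| ax_ext_equiv : forall G s (x y : term G s),
    H_HA_axioms (x ≡ y ⟶ Ext x ⟶ Ext y)
| ax_ext_const : forall G s (c : const s), @H_HA_axioms G (Ext (Const c)).

Inductive HE_HA_axioms : theory Extended :=
| ax_H_HA : forall G (A : form Extended G), H_HA_axioms A -> HE_HA_axioms A
| ax_extensional : forall G s t (f : term G (s ~> t)) (x y : term G s),
    HE_HA_axioms (Ext f ⟶ Ext x ⟶ Ext y ⟶ x ≐ y ⟶ f @ x ≐ f @ y).

Definition HA : theory Base := @HA_axioms Base.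
Definition H_HA : theory Extended := H_HA_axioms.
Definition HE_HA : theory Extended := HE_HA_axioms.

Fixpoint embed {L : lang} {G : ctx} (A : form L G) : form Extended G :=
  match A with
  | Bot => Bot
  | Equiv x y => Equiv x y
  | Ext x => Ext x
  | Eq x y => Eq x y
  | And B C => And (embed B) (embed C)
  | Or B C => Or (embed B) (embed C)
  | Imp B C => Imp (embed B) (embed C)
  | All s B => All s (embed B)
  | Ex s B => Ex s (embed B)
  end.

Fixpoint interp (E : forall s : ty, form Base [s]) (Q : forall s : ty, form Base [s; s])
    {L : lang} {G : ctx} (A : form L G) : form Base G :=
  match A with
  | Bot => Bot
  | Equiv x y => Equiv x y
  | Ext x => sub_form (E _) (scons x snil)
  | Eq x y => sub_form (Q _) (scons x (scons y snil))
  | And B C => And (interp E Q B) (interp E Q C)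
  | Or B C => Or (interp E Q B) (interp E Q C)
  | Imp B C => Imp (interp E Q B) (interp E Q C)
  | All s B => All s (interp E Q B)
  | Ex s B => Ex s (interp E Q B)
  end.

Definition conservative_extension (T : theory Base) (T' : theory Extended) : Prop :=
  forall (G : ctx) (A : form Base G), provable T' (embed A) <-> provable T A.

(* Main.v *)
(** Interpret [Ext] and [=] through the hereditarily extensional relation [per]:
    it is [≡] at type 0, componentwise at products, and relates [f] and [g] at
    an arrow type if it relates [f x] and [g y] whenever it relates [x] and [y].
    It is a partial equivalence relation.  Let [E x] be [per x x] and let
    [Q] be defined by the recursion that the axioms prescribe for [=].  On [E]
    the relations [Q] and [per] coincide, so the extensionality axiom follows from
    [per f f], and [E c] for a constant [c] is the fundamental lemma of logical
    relations. *)
Require Import Defs.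
From Stdlib Require Import List.
Import ListNotations.

Set Implicit Arguments.
Local Open Scope fm_scope.

(** * Substitution *)

(** The context index of the variable is a cons, so the motive is computed from that index and [P]
    is abstracted inside the match. This avoids transport along equalities of contexts. *)
Lemma var_cons_ind (s : ty) (G : ctx) (P : forall r, var (s :: G) r -> Prop) :
  P s vz -> (forall r (v : var G r), P r (vs v)) -> forall r v, P r v.
Proof.
  intros Hz Hs r v.
  refine (match v as v' in var D r' return
            match D return var D r' -> Prop with
            | [] => fun _ => True
            | s' :: D' => fun v' => forall P : forall r, var (s' :: D') r -> Prop,
                P s' vz -> (forall r w, P r (vs w)) -> P r' v'
            end v'
          with
          | vz => fun P Hz _ => Hz
          | vs w => fun P _ Hs => Hs _ w
          end P Hz Hs).
Qed.

Lemma var_nil (r : ty) : var [] r -> False.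
Proof.
  intros v.
  exact (match v in var D _ return match D with [] => False | _ => True end with
         | vz => I
         | vs _ => I
         end).
Qed.

Definition id_sub {G : ctx} : sub G G := fun _ v => Var v.

Definition comp_sub {D G F : ctx} (f : sub D G) (g : sub G F) : sub D F :=
  fun _ v => sub_term g (f _ v).

(** Substitutions are functions and functional extensionality is not assumed, so they are compared
    pointwise. *)
Definition sub_eq {D G : ctx} (f g : sub D G) : Prop := forall r v, f r v = g r v.

Lemma sub_term_ext D G (f g : sub D G) (s : ty) (x : term D s) :
  sub_eq f g -> sub_term f x = sub_term g x.
Proof. intros E; induction x; simpl; congruence. Qed.

Lemma sub_up_ext D G (s : ty) (f g : sub D G) :
  sub_eq f g -> sub_eq (sub_up (s := s) f) (sub_up g).
Proof. intros E; refine (var_cons_ind _ _ _); simpl; congruence. Qed.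

Lemma sub_form_ext L D (A : form L D) : forall G (f g : sub D G),
  sub_eq f g -> sub_form A f = sub_form A g.
Proof.
  induction A; intros F f g E; simpl; f_equal; auto using sub_term_ext, sub_up_ext.
Qed.

Lemma sub_term_id G (s : ty) (x : term G s) : sub_term id_sub x = x.
Proof. induction x; simpl; try congruence; reflexivity. Qed.

Lemma sub_up_id G (s : ty) : sub_eq (sub_up (s := s) (@id_sub G)) id_sub.
Proof. refine (var_cons_ind _ _ _); reflexivity. Qed.

Lemma sub_form_id L G (A : form L G) : sub_form A id_sub = A.
Proof.
  induction A; simpl; rewrite ?sub_term_id; f_equal; trivial.
  all: etransitivity; [apply sub_form_ext, sub_up_id | assumption].
Qed.

Lemma ren_term_sub D G (f : ren D G) (s : ty) (x : term D s) :
  ren_term f x = sub_term (fun r v => Var (f r v)) x.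
Proof. induction x; simpl; congruence. Qed.

(** Viewing renamings as substitutions by variables reduces every later commutation law for formulas
    to [sub_sub_form]. *)
Lemma ren_form_sub L D (A : form L D) : forall G (f : ren D G),
  ren_form A f = sub_form A (fun r v => Var (f r v)).
Proof.
  induction A; intros F f; simpl; f_equal; auto using ren_term_sub.
  all: rewrite IHA; apply sub_form_ext; refine (var_cons_ind _ _ _); reflexivity.
Qed.

Lemma sub_ren_term D G F (f : ren D G) (g : sub G F) (s : ty) (x : term D s) :
  sub_term g (ren_term f x) = sub_term (fun r v => g r (f r v)) x.
Proof. induction x; simpl; congruence. Qed.

Lemma ren_sub_term D G F (f : sub D G) (g : ren G F) (s : ty) (x : term D s) :
  ren_term g (sub_term f x) = sub_term (fun r v => ren_term g (f r v)) x.
Proof. induction x; simpl; congruence. Qed.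

Lemma sub_sub_term D G F (f : sub D G) (g : sub G F) (s : ty) (x : term D s) :
  sub_term g (sub_term f x) = sub_term (comp_sub f g) x.
Proof. induction x; simpl; unfold comp_sub in *; congruence. Qed.

Lemma sub_up_wk_term D G (f : sub D G) (r s : ty) (x : term D s) :
  sub_term (sub_up (s := r) f) (wk_term x) = wk_term (sub_term f x).
Proof.
  unfold wk_term; rewrite sub_ren_term, ren_sub_term; apply sub_term_ext; intros ? ?; reflexivity.
Qed.

Lemma sub_up_comp D G F (f : sub D G) (g : sub G F) (s : ty) :
  sub_eq (comp_sub (sub_up (s := s) f) (sub_up g)) (sub_up (comp_sub f g)).
Proof.
  refine (var_cons_ind _ _ _); [reflexivity | intros r v].
  exact (sub_up_wk_term g s (f r v)).
Qed.

Lemma sub_sub_form L D (A : form L D) : forall G F (f : sub D G) (g : sub G F),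
  sub_form (sub_form A f) g = sub_form A (comp_sub f g).
Proof.
  induction A; intros G' F f g; simpl; f_equal; auto using sub_sub_term.
  all: rewrite IHA; apply sub_form_ext, sub_up_comp.
Qed.

Definition wk_sub {G : ctx} {r : ty} : sub G (r :: G) := fun _ v => Var (vs v).

Lemma wk_form_sub L G (r : ty) (A : form L G) :
  wk_form A = sub_form A (wk_sub (r := r)).
Proof. apply ren_form_sub. Qed.

Lemma sub_scons_wk_term D G (f : sub D G) (r s : ty) (y : term G r) (x : term D s) :
  sub_term (scons y f) (wk_term x) = sub_term f x.
Proof. unfold wk_term; rewrite sub_ren_term; apply sub_term_ext; intros ? ?; reflexivity. Qed.

Lemma sub_up_wk_form L D G (f : sub D G) (r : ty) (A : form L D) :
  sub_form (wk_form A) (sub_up (s := r) f) = wk_form (sub_form A f).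
Proof.
  rewrite !wk_form_sub, !sub_sub_form; apply sub_form_ext; intros s v.
  unfold comp_sub; simpl; apply ren_term_sub.
Qed.

Lemma sub_up_scons D G F (f : sub D G) (g : sub G F) (s : ty) (x : term F s) :
  sub_eq (comp_sub (sub_up f) (scons x g)) (scons x (comp_sub f g)).
Proof.
  refine (var_cons_ind _ _ _); [reflexivity | intros r v].
  apply sub_scons_wk_term.
Qed.

Lemma sub_form_up_scons L D G F (s : ty) (A : form L (s :: D)) (f : sub D G)
    (g : sub G F) (x : term F s) :
  sub_form (sub_form A (sub_up f)) (scons x g) = sub_form A (scons x (comp_sub f g)).
Proof. rewrite sub_sub_form; apply sub_form_ext, sub_up_scons. Qed.

Lemma inst_sub_up L D G (s : ty) (A : form L (s :: D)) (f : sub D G) (x : term G s) :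
  inst (sub_form A (sub_up f)) x = sub_form A (scons x f).
Proof.
  unfold inst; rewrite sub_form_up_scons; apply sub_form_ext.
  refine (var_cons_ind _ _ _); [reflexivity | intros r v; apply sub_term_id].
Qed.

Lemma sub_inst L D G (s : ty) (A : form L (s :: D)) (f : sub D G) (x : term D s) :
  sub_form (inst A x) f = inst (sub_form A (sub_up f)) (sub_term f x).
Proof.
  rewrite inst_sub_up; unfold inst; rewrite sub_sub_form; apply sub_form_ext.
  refine (var_cons_ind _ _ _); reflexivity.
Qed.

Lemma sub_inst_succ L D G (A : form L (Nat :: D)) (f : sub D G) :
  sub_form (inst_succ A) (sub_up f) = inst_succ (sub_form A (sub_up f)).
Proof.
  unfold inst_succ; rewrite !sub_sub_form; apply sub_form_ext.
  refine (var_cons_ind _ _ _); [reflexivity | intros r v].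
  etransitivity; [apply ren_term_sub | symmetry; apply sub_scons_wk_term].
Qed.

(** * Closure properties of provability *)

Definition sub_closed {L} (T : theory L) : Prop :=
  forall D G (A : form L D) (f : sub D G), T D A -> T G (sub_form A f).

(** A change of world in the Kripke sense: the context changes along [f] while the hypotheses may
    grow. *)
Definition hyp_le {L D G} (f : sub D G) (H : list (form L D)) (H' : list (form L G)) : Prop :=
  forall B, In B H -> In (sub_form B f) H'.

Lemma hyp_le_cons L D G (f : sub D G) (H : list (form L D)) H' (A : form L D) :
  hyp_le f H H' -> hyp_le f (A :: H) (sub_form A f :: H').
Proof. intros I B [<- | J]; [left; reflexivity | right; auto]. Qed.

Lemma hyp_le_wk L D G (f : sub D G) (H : list (form L D)) H' (s : ty) :
  hyp_le f H H' -> hyp_le (sub_up (s := s) f) (map wk_form H) (map wk_form H').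
Proof.
  intros I B J; apply in_map_iff in J as (C & <- & J).
  rewrite sub_up_wk_form; apply in_map; auto.
Qed.

(** Substitution and weakening of hypotheses go through one induction on derivations; at a
    quantifier rule, [f] is lifted under the binder. *)
Lemma prf_sub L (T : theory L) : sub_closed T ->
  forall D (H : list (form L D)) A, prf T H A ->
  forall G (f : sub D G) H', hyp_le f H H' -> prf T H' (sub_form A f).
Proof.
  intros cT D H A p; induction p; intros F f H' I; simpl in *.
  - apply p_ax, cT; assumption.
  - apply p_hyp; auto.
  - apply p_botE; eauto.
  - apply p_andI; eauto.
  - eapply p_andE1; eauto.
  - eapply p_andE2; eauto.
  - apply p_orI1; eauto.
  - apply p_orI2; eauto.
  - eapply p_orE; eauto using hyp_le_cons.
  - apply p_impI; eauto using hyp_le_cons.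
  - eapply p_impE; eauto.
  - apply p_allI; eauto using hyp_le_wk.
  - rewrite sub_inst; apply p_allE; eauto.
  - eapply p_exI; rewrite <- sub_inst; eauto.
  - eapply p_exE; [eauto |].
    rewrite <- sub_up_wk_form; eauto using hyp_le_cons, hyp_le_wk.
Qed.

Lemma HA_sub_closed L : sub_closed (@HA_axioms L).
Proof.
  intros D G A f a; revert f; destruct a; intros f;
    try (simpl; constructor; fail).
  (* The other axioms are schematic in terms; only induction needs substitution to commute with the
     instances at zero and successor. *)
  cbn [sub_form]; rewrite sub_inst, sub_inst_succ; apply ax_ind.
Qed.

(** * Translations between languages *)

Record translation {L L'} (F : forall G, form L G -> form L' G) : Prop := {
  tr_bot : forall G, F G Bot = Bot;
  tr_and : forall G A B, F G (And A B) = And (F G A) (F G B);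
  tr_or : forall G A B, F G (Or A B) = Or (F G A) (F G B);
  tr_imp : forall G A B, F G (Imp A B) = Imp (F G A) (F G B);
  tr_all : forall G s A, F G (All s A) = All s (F (s :: G) A);
  tr_ex : forall G s A, F G (Ex s A) = Ex s (F (s :: G) A);
  tr_sub : forall D G A (f : sub D G), F G (sub_form A f) = sub_form (F D A) f
}.

Section Translation.
  Context {L L' : lang} {F : forall G, form L G -> form L' G} (tF : translation F).

  Lemma tr_wk G (s : ty) (A : form L G) : F (wk_form (r := s) A) = wk_form (F A).
  Proof. rewrite !wk_form_sub; apply (tr_sub tF). Qed.

  Lemma map_tr_wk G (s : ty) (H : list (form L G)) :
    map (@F _) (map (wk_form (r := s)) H) = map wk_form (map (@F G) H).
  Proof. rewrite !map_map; apply map_ext; intros A; apply tr_wk. Qed.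

  Lemma tr_inst G (s : ty) (A : form L (s :: G)) (x : term G s) :
    F (inst A x) = inst (F A) x.
  Proof. apply (tr_sub tF). Qed.

  (** Each rule is sent to the same rule, the quantifier rules using commutation with substitution,
      so only axioms need checking. This serves both [interp] and [embed]. *)
  Lemma prf_translation (T : theory L) (T' : theory L') :
    (forall G H A, T G A -> prf T' H (F A)) ->
    forall G (H : list (form L G)) A, prf T H A -> prf T' (map (@F G) H) (F A).
  Proof.
    intros ax G H A p; induction p; simpl in *;
      rewrite ?(tr_bot tF), ?(tr_and tF), ?(tr_or tF), ?(tr_imp tF), ?(tr_all tF),
        ?(tr_ex tF), ?map_tr_wk, ?tr_wk, ?tr_inst in *.
    - auto.
    - apply p_hyp, in_map; assumption.
    - apply p_botE; assumption.
    - apply p_andI; assumption.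
    - eapply p_andE1; eassumption.
    - eapply p_andE2; eassumption.
    - apply p_orI1; assumption.
    - apply p_orI2; assumption.
    - eapply p_orE; eassumption.
    - apply p_impI; assumption.
    - eapply p_impE; eassumption.
    - apply p_allI; assumption.
    - apply p_allE; assumption.
    - eapply p_exI; eassumption.
    - eapply p_exE; eassumption.
  Qed.

  Lemma translation_HA :
    (forall G (s : ty) (x y : term G s), F (x ≡ y) = (x ≡ y)) ->
    forall G (A : form L G), HA_axioms A -> HA_axioms (F A).
  Proof.
    intros tE G A a; destruct a;
      unfold Not; rewrite ?(tr_imp tF), ?(tr_all tF), ?(tr_imp tF), ?(tr_bot tF), ?tE, ?tr_inst;
      try (constructor; fail).
    unfold inst_succ; rewrite (tr_sub tF); apply ax_ind.
  Qed.
End Translation.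

Lemma embed_translation L : translation (fun G => @embed L G).
Proof.
  split; try reflexivity.
  intros D G A; revert G; induction A; intros F f; simpl; f_equal; auto.
Qed.

Lemma interp_translation (E : forall s, form Base [s]) (Q : forall s, form Base [s; s]) L :
  translation (fun G => @interp E Q L G).
Proof.
  split; try reflexivity.
  intros D G A; revert G; induction A; intros F f; simpl; f_equal; auto.
  (* At atoms [Ext] and [Eq], the formulas [E] and [Q] have no free variables besides their argument
     places, so the substitution acts on the arguments alone. *)
  all: rewrite sub_sub_form; apply sub_form_ext.
  all: repeat refine (var_cons_ind _ _ _); try reflexivity.
  all: intros r v; destruct (var_nil v).
Qed.

Lemma interp_embed (E : forall s, form Base [s]) (Q : forall s, form Base [s; s])
    (G : ctx) (A : form Base G) : interp E Q (embed A) = A.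
Proof.
  (* Induction on formulas needs a variable language index; the match makes the claim trivial at
     [Extended]. *)
  enough (forall L (B : form L G),
    match L return form L G -> Prop with
    | Base => fun B => interp E Q (embed B) = B
    | Extended => fun _ => True
    end B) as I by exact (I Base A).
  clear A; intros L B; induction B; try exact I; destruct L; try exact I;
    simpl; congruence.
Qed.

(** * Derived rules of [HA] *)

Local Notation "H ⊢ A" := (prf HA H A%fm) (at level 100, A at level 200, no associativity).

Lemma HA_sub D (H : list (form Base D)) A G (f : sub D G) H' :
  (H ⊢ A) -> hyp_le f H H' -> H' ⊢ sub_form A f.
Proof. intros p I; exact (prf_sub (@HA_sub_closed Base) p I). Qed.

Lemma hyp_le_comp L D G F (f : sub D G) (g : sub G F) (H : list (form L D)) H' H'' :
  hyp_le f H H' -> hyp_le g H' H'' -> hyp_le (comp_sub f g) H H''.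
Proof. intros I J B K; rewrite <- sub_sub_form; auto. Qed.

Lemma hyp_le_tl L D G (f : sub D G) (H : list (form L D)) H' A :
  hyp_le f H H' -> hyp_le f H (A :: H').
Proof. intros I B J; right; auto. Qed.

(** Kripke-style generalization: the premise ranges over all later worlds and all terms there, and
    the eigenvariable is one instance. Later proofs can thus work with arbitrary terms instead of
    bound variables. *)
Lemma all_intro G (H : list (form Base G)) s (A : form Base (s :: G)) :
  (forall D (f : sub G D) H', hyp_le f H H' ->
     forall x : term D s, H' ⊢ sub_form A (scons x f)) ->
  H ⊢ All s A.
Proof.
  intros p; apply p_allI.
  (* The identity substitution is split into the new variable and the weakening, which is the
     instance of the premise that is needed. *)
  rewrite <- (sub_form_id A), <- (sub_form_ext A (f := scons (Var vz) wk_sub)).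
  - apply p; intros B I; rewrite <- wk_form_sub; apply in_map; assumption.
  - refine (var_cons_ind _ _ _); reflexivity.
Qed.

Lemma HA_refl G (H : list (form Base G)) s (x : term G s) : H ⊢ x ≡ x.
Proof. apply p_ax, ax_refl. Qed.

Lemma HA_sym G (H : list (form Base G)) s (x y : term G s) : (H ⊢ x ≡ y) -> H ⊢ y ≡ x.
Proof. apply p_impE, p_ax, ax_sym. Qed.

Lemma HA_trans G (H : list (form Base G)) s (x y z : term G s) :
  (H ⊢ x ≡ y) -> (H ⊢ y ≡ z) -> H ⊢ x ≡ z.
Proof. intros p; apply p_impE; revert p; apply p_impE, p_ax, ax_trans. Qed.

Lemma HA_cong G (H : list (form Base G)) s t (f g : term G (s ~> t)) (x y : term G s) :
  (H ⊢ f ≡ g) -> (H ⊢ x ≡ y) -> H ⊢ f @ x ≡ g @ y.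
Proof. intros p; apply p_impE; revert p; apply p_impE, p_ax, ax_cong. Qed.

Lemma HA_ind G (H : list (form Base G)) (A : form Base (Nat :: G)) :
  (H ⊢ inst A zero) ->
  (forall D (f : sub G D) H' (n : term D Nat), hyp_le f H H' ->
     (H' ⊢ sub_form A (scons n f)) -> H' ⊢ sub_form A (scons (succ @ n)%tm f)) ->
  forall n, H ⊢ inst A n.
Proof.
  intros p0 pS n; apply p_allE.
  refine (p_impE (p_impE (p_ax HA H _ (ax_ind A)) p0) _).
  apply all_intro; intros D f H' I m; simpl; apply p_impI.
  assert (sub_form (inst_succ A) (scons m f) = sub_form A (scons (succ @ m)%tm f)) as ->.
  { unfold inst_succ; rewrite sub_sub_form; apply sub_form_ext.
    refine (var_cons_ind _ _ _); reflexivity. }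
  apply pS; [apply hyp_le_tl; assumption | apply p_hyp; left; reflexivity].
Qed.

(** * The extensional relation *)

(** This has the shape of the [Eq] clause of [interp], so interpreted equations are instances of
    [rel] by conversion. *)
Definition rel {G s} (A : form Base [s; s]) (x y : term G s) : form Base G :=
  sub_form A (scons x (scons y snil)).

Lemma sub_rel D G s (A : form Base [s; s]) (x y : term D s) (f : sub D G) :
  sub_form (rel A x y) f = rel A (sub_term f x) (sub_term f y).
Proof.
  unfold rel; rewrite sub_sub_form; apply sub_form_ext.
  repeat refine (var_cons_ind _ _ _); try reflexivity.
  intros r v; destruct (var_nil v).
Qed.

(** In the arrow clause, under both quantifiers, indices 0 and 1 are the second and the first
    argument, and indices 2 and 3 are the first and the second function. *)
Fixpoint per_form (s : ty) : form Base [s; s] :=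
  match s with
  | Nat => Var vz ≡ Var (vs vz)
  | Prod a b =>
      And (rel (per_form a) (fst_ @ Var vz) (fst_ @ Var (vs vz)))
          (rel (per_form b) (snd_ @ Var vz) (snd_ @ Var (vs vz)))
  | Arr a b =>
      All a (All a (rel (per_form a) (Var (vs vz)) (Var vz) ⟶
                    rel (per_form b) (Var (vs (vs vz)) @ Var (vs vz))
                                     (Var (vs (vs (vs vz))) @ Var vz)))
  end.

Definition per {G s} (x y : term G s) : form Base G := rel (per_form s) x y.

Definition ext_form (s : ty) : form Base [s] := per (Var vz) (Var vz).

(** The arrow clause quantifies over one self-related argument, as the axiom for equality at arrow
    types prescribes; [per_form] takes two related arguments. *)
Fixpoint eqv_form (s : ty) : form Base [s; s] :=
  match s with
  | Nat => Var vz ≡ Var (vs vz)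
  | Prod a b =>
      And (rel (eqv_form a) (fst_ @ Var vz) (fst_ @ Var (vs vz)))
          (rel (eqv_form b) (snd_ @ Var vz) (snd_ @ Var (vs vz)))
  | Arr a b =>
      All a (per (Var vz) (Var vz) ⟶
             rel (eqv_form b) (Var (vs vz) @ Var vz) (Var (vs (vs vz)) @ Var vz))
  end.

Definition eqv {G s} (x y : term G s) : form Base G := rel (eqv_form s) x y.

Lemma sub_per D G s (x y : term D s) (f : sub D G) :
  sub_form (per x y) f = per (sub_term f x) (sub_term f y).
Proof. apply sub_rel. Qed.

Lemma sub_eqv D G s (x y : term D s) (f : sub D G) :
  sub_form (eqv x y) f = eqv (sub_term f x) (sub_term f y).
Proof. apply sub_rel. Qed.

(** The unfolding laws are equalities of formulas, not just provable equivalences; the defining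
    axioms of [Ext] at products and of [Eq] thereby become instances of [Iff A A]. *)
Lemma per_prod G a b (x y : term G (a ** b)) :
  per x y = And (per (fst_ @ x) (fst_ @ y)) (per (snd_ @ x) (snd_ @ y)).
Proof. unfold per at 1, rel at 1; simpl; rewrite !sub_rel; reflexivity. Qed.

Lemma eqv_prod G a b (x y : term G (a ** b)) :
  eqv x y = And (eqv (fst_ @ x) (fst_ @ y)) (eqv (snd_ @ x) (snd_ @ y)).
Proof. unfold eqv at 1, rel at 1; simpl; rewrite !sub_rel; reflexivity. Qed.

Lemma per_arr G a b (f g : term G (a ~> b)) :
  per f g =
  All a (All a (per (Var (vs vz)) (Var vz) ⟶
                per (wk_term (wk_term f) @ Var (vs vz)) (wk_term (wk_term g) @ Var vz))).
Proof. unfold per at 1, rel at 1; simpl; rewrite !sub_rel; reflexivity. Qed.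

Lemma eqv_arr G a b (f g : term G (a ~> b)) :
  eqv f g =
  All a (per (Var vz) (Var vz) ⟶ eqv (wk_term f @ Var vz) (wk_term g @ Var vz)).
Proof.
  unfold eqv at 1, rel at 1; simpl; rewrite sub_per, sub_rel; reflexivity.
Qed.

(** * Introduction and elimination rules for the two relations *)

Lemma HA_per_sub {D G s} {H : list (form Base D)} {H'} {x y : term D s} {f : sub D G} :
  (H ⊢ per x y) -> hyp_le f H H' -> H' ⊢ per (sub_term f x) (sub_term f y).
Proof. rewrite <- sub_per; apply HA_sub. Qed.

Lemma HA_eqv_sub {D G s} {H : list (form Base D)} {H'} {x y : term D s} {f : sub D G} :
  (H ⊢ eqv x y) -> hyp_le f H H' -> H' ⊢ eqv (sub_term f x) (sub_term f y).
Proof. rewrite <- sub_eqv; apply HA_sub. Qed.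

Lemma per_app {G} {H : list (form Base G)} {a b} {f g : term G (a ~> b)} {x y} :
  (H ⊢ per f g) -> (H ⊢ per x y) -> H ⊢ per (f @ x)%tm (g @ y)%tm.
Proof.
  rewrite per_arr; intros p; apply (p_allE x) in p.
  unfold inst in p; simpl in p; apply (p_allE y) in p.
  unfold inst in p; simpl in p; rewrite !sub_form_up_scons, !sub_per in p; simpl in p.
  (* The instantiations cancel against the weakenings of [f] and [g], leaving identity
     substitutions. *)
  rewrite !sub_scons_wk_term, <- !sub_sub_term, !sub_scons_wk_term in p.
  unfold comp_sub in p; simpl in p.
  fold (@id_sub G) in p; rewrite !sub_term_id in p.
  exact (p_impE p).
Qed.

Lemma eqv_app {G} {H : list (form Base G)} {a b} {f g : term G (a ~> b)} {x} :
  (H ⊢ eqv f g) -> (H ⊢ per x x) -> H ⊢ eqv (f @ x)%tm (g @ x)%tm.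
Proof.
  rewrite eqv_arr; intros p; apply (p_allE x) in p.
  unfold inst in p; simpl in p; rewrite sub_per, sub_eqv in p; simpl in p.
  rewrite !sub_scons_wk_term in p; fold (@id_sub G) in p; rewrite !sub_term_id in p.
  exact (p_impE p).
Qed.

(** Together with [per_app], this hides the quantifiers in [per] at arrow types: arguments about
    functions become semantic ones, over related terms in any later world. *)
Lemma per_lam G (H : list (form Base G)) a b (f g : term G (a ~> b)) :
  (forall D (u : sub G D) H' (x y : term D a), hyp_le u H H' -> (H' ⊢ per x y) ->
     H' ⊢ per (sub_term u f @ x)%tm (sub_term u g @ y)%tm) ->
  H ⊢ per f g.
Proof.
  intros p; rewrite per_arr.
  apply all_intro; intros D u H' I x; simpl.
  apply all_intro; intros D' u' H'' I' y; simpl.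
  rewrite !sub_form_up_scons, !sub_per; simpl; rewrite !sub_scons_wk_term, <- !sub_sub_term, !sub_scons_wk_term.
  apply p_impI; rewrite !sub_sub_term; apply p.
  - eauto using hyp_le_tl, hyp_le_comp.
  - apply p_hyp; left; reflexivity.
Qed.

Lemma eqv_lam G (H : list (form Base G)) a b (f g : term G (a ~> b)) :
  (forall D (u : sub G D) H' (x : term D a), hyp_le u H H' -> (H' ⊢ per x x) ->
     H' ⊢ eqv (sub_term u f @ x)%tm (sub_term u g @ x)%tm) ->
  H ⊢ eqv f g.
Proof.
  intros p; rewrite eqv_arr.
  apply all_intro; intros D u H' I x; simpl.
  rewrite sub_per, sub_eqv; simpl; rewrite !sub_scons_wk_term.
  apply p_impI, p; [apply hyp_le_tl; assumption | apply p_hyp; left; reflexivity].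
Qed.

(** The computation axioms of the constants are stated with [≡]; this carries them over to [per].
    Congruence of application suffices at products and arrows. *)
Lemma per_conv s : forall G (H : list (form Base G)) (x x' y y' : term G s),
  (H ⊢ x' ≡ x) -> (H ⊢ y' ≡ y) -> (H ⊢ per x y) -> H ⊢ per x' y'.
Proof.
  induction s as [| a IHa b IHb | a IHa b IHb]; intros G H x x' y y' ex ey p.
  - apply HA_trans with x; [exact ex |].
    apply HA_trans with y; [exact p | apply HA_sym; exact ey].
  - rewrite per_prod in p |- *; apply p_andI.
    + apply p_andE1 in p; revert p; apply IHa; apply HA_cong; auto using HA_refl.
    + apply p_andE2 in p; revert p; apply IHb; apply HA_cong; auto using HA_refl.
  - apply per_lam; intros D u H' z z' I q.
    apply IHb with (sub_term u x @ z)%tm (sub_term u y @ z')%tm.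
    + apply HA_cong; [exact (HA_sub ex I) | apply HA_refl].
    + apply HA_cong; [exact (HA_sub ey I) | apply HA_refl].
    + apply per_app; [exact (HA_per_sub p I) | exact q].
Qed.

Lemma per_sym {s} : forall {G} {H : list (form Base G)} {x y : term G s},
  (H ⊢ per x y) -> H ⊢ per y x.
Proof.
  induction s as [| a IHa b IHb | a IHa b IHb]; intros G H x y p.
  - apply HA_sym; exact p.
  - rewrite per_prod in p |- *; apply p_andI; [apply IHa | apply IHb].
    + exact (p_andE1 p).
    + exact (p_andE2 p).
  - apply per_lam; intros D u H' z z' I q.
    apply IHb, per_app; [exact (HA_per_sub p I) | apply IHa, q].
Qed.

Lemma per_trans {s} : forall {G} {H : list (form Base G)} {x} (y : term G s) {z},
  (H ⊢ per x y) -> (H ⊢ per y z) -> H ⊢ per x z.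
Proof.
  induction s as [| a IHa b IHb | a IHa b IHb]; intros G H x y z p q.
  - exact (HA_trans p q).
  - rewrite per_prod in p, q |- *; apply p_andI.
    + exact (IHa _ _ _ _ _ (p_andE1 p) (p_andE1 q)).
    + exact (IHb _ _ _ _ _ (p_andE2 p) (p_andE2 q)).
  - apply per_lam; intros D u H' v w I r.
    (* The midpoint is [y v]. The second link [y v ~ z w] comes directly from the related arguments,
       but the first needs [v] related to itself, which symmetry and transitivity supply. *)
    apply IHb with (sub_term u y @ v)%tm.
    + apply per_app; [exact (HA_per_sub p I) |].
      exact (IHa _ _ _ _ _ r (per_sym r)).
    + exact (per_app (HA_per_sub q I) r).
Qed.

(** Self-relatedness of both functions bridges the gap at arrows: agreement on equal arguments then
    extends to agreement on related ones. *)
Lemma eqv_per s : forall G (H : list (form Base G)) (x y : term G s),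
  (H ⊢ per x x) -> (H ⊢ per y y) -> (H ⊢ eqv x y) <-> (H ⊢ per x y).
Proof.
  induction s as [| a IHa b IHb | a IHa b IHb]; intros G H x y px py.
  - reflexivity.
  - rewrite per_prod in px, py |- *; rewrite eqv_prod.
    split; intros p; apply p_andI.
    + apply IHa; [exact (p_andE1 px) | exact (p_andE1 py) | exact (p_andE1 p)].
    + apply IHb; [exact (p_andE2 px) | exact (p_andE2 py) | exact (p_andE2 p)].
    + apply IHa; [exact (p_andE1 px) | exact (p_andE1 py) | exact (p_andE1 p)].
    + apply IHb; [exact (p_andE2 px) | exact (p_andE2 py) | exact (p_andE2 p)].
  - split; intros p.
    + apply per_lam; intros D u H' v w I r.
      assert (H' ⊢ per v v) as rv by exact (per_trans _ r (per_sym r)).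
      (* From [x v] to [y v] by [eqv] at the self-related [v], then from [y v] to [y w] because [y]
         is related to itself. *)
      apply per_trans with (sub_term u y @ v)%tm.
      * apply IHb.
        -- exact (per_app (HA_per_sub px I) rv).
        -- exact (per_app (HA_per_sub py I) rv).
        -- exact (eqv_app (HA_eqv_sub p I) rv).
      * exact (per_app (HA_per_sub py I) r).
    + apply eqv_lam; intros D u H' v I r; apply IHb.
      * exact (per_app (HA_per_sub px I) r).
      * exact (per_app (HA_per_sub py I) r).
      * exact (per_app (HA_per_sub p I) r).
Qed.

(** * Self-relatedness of the constants *)

Lemma per_rec G (H : list (form Base G)) s (x x' : term G s) f f' n :
  (H ⊢ per x x') -> (H ⊢ per f f') ->
  H ⊢ per (Rec @ x @ f @ n)%tm (Rec @ x' @ f' @ n)%tm.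
Proof.
  intros px pf.
  (* Induction inside the theory, with the same number on both sides; distinct but related numbers
     are handled in [per_const], since at type 0 relatedness is [≡]. *)
  set (A := per (Rec @ wk_term x @ wk_term f @ Var vz)%tm
                (Rec @ wk_term x' @ wk_term f' @ Var vz)%tm : form Base (Nat :: G)).
  assert (forall D (u : sub G D) m,
    sub_form A (scons m u) =
    per (Rec @ sub_term u x @ sub_term u f @ m)%tm
        (Rec @ sub_term u x' @ sub_term u f' @ m)%tm) as subA.
  { intros D u m; unfold A; rewrite sub_per; simpl; rewrite !sub_scons_wk_term; reflexivity. }
  assert (forall m, inst A m = per (Rec @ x @ f @ m)%tm (Rec @ x' @ f' @ m)%tm) as instA.
  { intros m; unfold inst; rewrite subA; fold (@id_sub G); rewrite !sub_term_id; reflexivity. }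
  rewrite <- instA; apply HA_ind.
  - rewrite instA; revert px; apply per_conv; apply p_ax, ax_rec0.
  - intros D u H' m I; rewrite !subA; intros p.
    eapply per_conv; [apply p_ax, ax_recS | apply p_ax, ax_recS |].
    apply per_app; [| exact p].
    apply per_app; [exact (HA_per_sub pf I) | apply HA_refl].
Qed.

(** Related arguments are supplied with [per_lam], the computation axiom is applied on both sides,
    and [per_app] reassembles the results. *)
Lemma per_const G (H : list (form Base G)) s (c : const s) : H ⊢ per (Const c) (Const c).
Proof.
  destruct c.
  - apply per_lam; intros D1 u1 H1 x x' I1 px.
    apply per_lam; intros D2 u2 H2 y y' I2 py; simpl.
    eapply per_conv; [apply p_ax, ax_k | apply p_ax, ax_k |].
    exact (HA_per_sub px I2).
  - apply per_lam; intros D1 u1 H1 x x' I1 px.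
    apply per_lam; intros D2 u2 H2 y y' I2 py; simpl.
    apply per_lam; intros D3 u3 H3 z z' I3 pz; simpl.
    eapply per_conv; [apply p_ax, ax_s | apply p_ax, ax_s |].
    apply per_app; (apply per_app; [| exact pz]).
    + exact (HA_per_sub (HA_per_sub px I2) I3).
    + exact (HA_per_sub py I3).
  - apply per_lam; intros D1 u1 H1 x x' I1 px.
    apply per_lam; intros D2 u2 H2 y y' I2 py; simpl.
    rewrite per_prod; apply p_andI.
    + eapply per_conv; [apply p_ax, ax_fst | apply p_ax, ax_fst |].
      exact (HA_per_sub px I2).
    + eapply per_conv; [apply p_ax, ax_snd | apply p_ax, ax_snd |]; exact py.
  - apply per_lam; intros D u H' x x' I p; rewrite per_prod in p; exact (p_andE1 p).
  - apply per_lam; intros D u H' x x' I p; rewrite per_prod in p; exact (p_andE2 p).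
  - apply HA_refl.
  - apply per_lam; intros D u H' x x' I p; apply HA_cong; [apply HA_refl | exact p].
  - apply per_lam; intros D1 u1 H1 x x' I1 px.
    apply per_lam; intros D2 u2 H2 f f' I2 pf; simpl.
    apply per_lam; intros D3 u3 H3 n n' I3 pn; simpl.
    (* Since [n ≡ n'], the right recursor may be evaluated at [n], which brings the goal to the form
       of [per_rec]. *)
    eapply per_conv; [apply HA_refl | | apply per_rec].
    + apply HA_cong; [apply HA_refl | apply HA_sym; exact pn].
    + exact (HA_per_sub (HA_per_sub px I2) I3).
    + exact (HA_per_sub pf I3).
Qed.

(** * The interpretation of the axioms *)

Lemma HA_iff_refl G (H : list (form Base G)) A : H ⊢ Iff A A.
Proof. apply p_andI; apply p_impI, p_hyp; left; reflexivity. Qed.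

Lemma interp_H_HA G (A : form Extended G) H :
  H_HA A -> H ⊢ interp ext_form eqv_form A.
Proof.
  intros a; destruct a; unfold Iff, AllExt; cbn [interp]; unfold ext_form.
  - apply p_ax, (translation_HA (interp_translation ext_form eqv_form _)); auto.
  - apply HA_iff_refl.
  - apply p_allI, HA_refl.
  (* The interpreted equations are convertible to [eqv], and its unfolding law makes both sides of
     the axiom identical. *)
  - change (H ⊢ Iff (eqv x y) (And (eqv (fst_ @ x) (fst_ @ y)) (eqv (snd_ @ x) (snd_ @ y)))).
    rewrite eqv_prod; apply HA_iff_refl.
  - rewrite !sub_per; simpl; rewrite per_prod; apply HA_iff_refl.
  - rewrite sub_per.
    change (H ⊢ Iff (eqv f g)
      (All s (per (Var vz) (Var vz) ⟶ eqv (wk_term f @ Var vz) (wk_term g @ Var vz)))).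
    rewrite eqv_arr; apply HA_iff_refl.
  - rewrite !sub_per; simpl; do 2 apply p_impI.
    apply per_app; apply p_hyp; simpl; auto.
  - rewrite !sub_per; simpl; do 2 apply p_impI.
    (* Both occurrences of [y] in [per y y] are replaced by [x], using the symmetric form of
       [x ≡ y]. *)
    apply per_conv with x x; try (apply HA_sym); apply p_hyp; simpl; auto.
  - rewrite sub_per; apply per_const.
Qed.

Lemma interp_HE_HA G (A : form Extended G) H :
  HE_HA A -> H ⊢ interp ext_form eqv_form A.
Proof.
  intros a; destruct a; [apply interp_H_HA; assumption |]; cbn [interp]; unfold ext_form.
  rewrite !sub_per; simpl; do 4 apply p_impI.
  set (H' := _ :: _ :: _ :: _ :: H).
  assert (H' ⊢ per f f) as pf by (apply p_hyp; unfold H'; simpl; auto 6).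
  assert (H' ⊢ per x x) as px by (apply p_hyp; unfold H'; simpl; auto 6).
  assert (H' ⊢ per y y) as py by (apply p_hyp; unfold H'; simpl; auto 6).
  assert (H' ⊢ eqv x y) as e by (apply p_hyp; left; reflexivity).
  (* The equation is moved to [per], where [per f f] applies, and moved back for [f x] and [f y],
     which are self-related as well. *)
  apply eqv_per; apply per_app; auto.
  apply eqv_per; assumption.
Qed.

Theorem theorem4p3 :
  (exists (E : forall s : ty, form Base [s]) (Q : forall s : ty, form Base [s; s]),
      (forall (G : ctx) (A : form Base G), interp E Q (embed A) = A) /\
      (forall (G : ctx) (A : form Extended G),
          provable HE_HA A -> provable HA (interp E Q A)))
  /\ conservative_extension HA HE_HA.
Proof.
  assert (forall G (A : form Extended G),
    provable HE_HA A -> provable HA (interp ext_form eqv_form A)) as sound.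
  { intros G A; apply (prf_translation (interp_translation ext_form eqv_form Extended)).
    intros; apply interp_HE_HA; assumption. }
  split; [exists ext_form, eqv_form; split; [apply interp_embed | exact sound] |].
  intros G A; split; intros p.
  (* Conservativity: the interpretation fixes formulas of the base language, so the interpreted
     proof already proves the original formula. *)
  - apply sound in p; rewrite interp_embed in p; exact p.
  (* Conversely, embedding sends each axiom of the base theory to an axiom of the extended one. *)
  - revert p; apply (prf_translation (embed_translation Base)).
    intros; apply p_ax, ax_H_HA, ax_HA, (translation_HA (embed_translation Base)); auto.
Qed.
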